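(* For any integers $k\in\mathbb{N}$ and $\ell,m,n\in\mathbb{N}_{>0}$ with $k\le n$, and any Mealy machine $T=(S,s_0,\Sigma=\{0,1\}^{\ell},\Lambda\subseteq\{0,1\}^m,t,o)$, there is a $k$-bit hazard-free circuit implementing the transcription function $\tau_{T,n}$. With $\kappa:=\sum_{i=0}^{\min\{|S|,2^k\}}\binom{|S|}{i}$ and $\lambda:=\min\{m,2^{|S|\cdot|\Sigma|}\}$, the circuit has size $$O\left(\left(\kappa^3+(2^{\ell}/\ell)\kappa^2+2^{\ell}\kappa\lambda\right)n\right)$$ and depth $$O\left(\log\kappa\,\log n+\ell\right).$$ (The constants hidden in the $O$-notation are absolute.)
   Context: Ternary logic. Let $\mathbb{B}=\{0,1\}$ and $\mathbb{T}=\{0,1,\mathfrak{u}\}$. The basic gates act on $\mathbb{T}$ by Kleene's strong logic: $\mathtt{and}$ outputs $0$ if some input is $0$, $1$ if both inputs are $1$, and $\mathfrak{u}$ otherwise; $\mathtt{or}$ outputs $1$ if some input is $1$, $0$ if both inputs are $0$, and $\mathfrak{u}$ otherwise; $\mathtt{not}(0)=1$, $\mathtt{not}(1)=0$, $\mathtt{not}(\mathfrak{u})=\mathfrak{u}$. A circuit is a combinational (acyclic) circuit of two-input $\mathtt{and}$, two-input $\mathtt{or}$, $\mathtt{not}$, and constant-$0$/constant-$1$ gates; a circuit $C$ with $N$ inputs and $M$ outputs computes a function $C:\mathbb{T}^N\to\mathbb{T}^M$ by induction on its structure. Its size is its number of gates and its depth is the maximal number of gates on a path from input to output. Superposition: for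 $x,y\in\mathbb{T}$, $x*y=x$ if $x=y$ and $x*y=\mathfrak{u}$ otherwise; extended componentwise to strings. It is associative and commutative, so the superposition of a nonempty finite set (or family) of strings is defined. Resolution: for $x\in\mathbb{T}^N$, $\mathrm{res}(x)=\{y\in\mathbb{B}^N : x_i\ne\mathfrak{u}\Rightarrow y_i=x_i \text{ for all } i\}$. The hazard-free extension of $f:\mathbb{B}^N\to\mathbb{B}^M$ is $f_{\mathfrak{u}}:\mathbb{T}^N\to\mathbb{T}^M$, where $f_{\mathfrak{u}}(x)$ is the superposition of all $f(y)$, $y\in\mathrm{res}(x)$. A circuit $C$ implements $f$ if $C(x)=f(x)$ for all $x\in\mathbb{B}^N$. A circuit $C$ implementing $f$ is $k$-bit hazard-free if $C(x)=f_{\mathfrak{u}}(x)$ for every $x\in\mathbb{T}^N$ in which $\mathfrak{u}$ appears at most $k$ times. A Mealy machine $T=(S,s_0,\Sigma,\Lambda,t,o)$ consists of a finite set of states $S$, a starting state $s_0\in S$, finite input alphabet $\Sigma$, finite output alphabet $\Lambda$, a state transition function $t:S\times\Sigma\to S$, and an output function $o:S\times\Sigma\to\Lambda$. Its transcription function $\tau_{T,n}:\Sigma^n\to\Lambda^n$ is given by $\tau_{T,n}(x)_i=o(s_{i-1},x_i)$ for $i\in\{1,\dots,n\}$, where $s_i=t(s_{i-1},x_i)$. When $\Sigma=\mathbb{B}^\ell$ and $\Lambda\subseteq\mathbb{B}^m$, $\tau_{T,n}$ is regarded as a Boolean function $\mathbb{B}^{\ell n}\to\mathbb{B}^{mn}$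 by concatenating symbols. *)

(* Defs.v *)
From HB Require Import structures.
From mathcomp Require Import all_boot all_order all_algebra.
From mathcomp Require Import reals exp.

Set Implicit Arguments.
Unset Strict Implicit.
Unset Printing Implicit Defensive.

(* The ternary values: [Some false] is 0, [Some true] is 1, [None] is the
   unstable value u. *)
Notation ternary := (option bool).

Definition kleene_and (a b : ternary) : ternary :=
  match a, b with
  | Some false, _ | _, Some false => Some false
  | Some true, Some true => Some true
  | _, _ => None
  end.

Definition kleene_or (a b : ternary) : ternary :=
  match a, b with
  | Some true, _ | _, Some true => Some true
  | Some false, Some false => Some false
  | _, _ => None
  end.

Definition kleene_not (a : ternary) : ternary := omap negb a.

Inductive gate : Type :=
  | And of nat & nat
  | Or of nat & nat
  | Not of nat
  | Const of bool.

Definition operands (g : gate) : seq nat :=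
  match g with
  | And v w | Or v w => [:: v; w]
  | Not v => [:: v]
  | Const _ => [::]
  end.

(* Wires are numbered: [0 .. N-1] are the inputs, and wire [N + i] carries the
   value of the [i]-th gate.  Gates are listed in a topological order, so
   acyclicity says that gate [i] only reads wires numbered below [N + i].
   Fan-out is unrestricted, and an output may be any wire. *)
Record circuit (N M : nat) := Circuit {
  gates : seq gate;
  outputs : M.-tuple nat;
  gates_acyclic : forall i, i < size gates ->
    all (fun v => v < N + i) (operands (nth (Const false) gates i));
  outputs_valid : all (fun v => v < N + size gates) outputs
}.

Definition gate_value (vs : seq ternary) (g : gate) : ternary :=
  match g with
  | And v w => kleene_and (nth None vs v) (nth None vs w)
  | Or v w => kleene_or (nth None vs v) (nth None vs w)
  | Not v => kleene_not (nth None vs v)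
  | Const b => Some b
  end.

Definition wire_values N M (C : circuit N M) (x : N.-tuple ternary)
    : seq ternary :=
  foldl (fun vs g => rcons vs (gate_value vs g)) x (gates C).

Definition circuit_eval N M (C : circuit N M) (x : N.-tuple ternary)
    : M.-tuple ternary :=
  [tuple nth None (wire_values C x) (tnth (outputs C) j) | j < M].

Definition circuit_size N M (C : circuit N M) : nat := size (gates C).

Definition feeds N M (C : circuit N M) (v w : nat) : bool :=
  (N <= w) && (v \in operands (nth (Const false) (gates C) (w - N))).

(* A path with exactly [d] gates, namely those driving the wires in [p]. *)
Definition has_io_path N M (C : circuit N M) (d : nat) : bool :=
  [exists v : 'I_N, [exists p : d.-tuple 'I_(N + size (gates C)),
    path (feeds C) v (map val p) && (last (val v) (map val p) \in outputs C)]].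

(* Wire numbers increase along a path, so no path has more gates than [C]. *)
Definition circuit_depth N M (C : circuit N M) : nat :=
  \max_(d < (size (gates C)).+1 | has_io_path C d) d.

Definition stable N (y : N.-tuple bool) : N.-tuple ternary :=
  map_tuple Some y.

Definition superpose (a b : ternary) : ternary := if a == b then a else None.

Definition superpose_tuple N (x y : N.-tuple ternary) : N.-tuple ternary :=
  [tuple superpose (tnth x i) (tnth y i) | i < N].

(* Only meaningful for a nonempty [s]; the value on [[::]] is junk. *)
Definition superposition N (s : seq (N.-tuple ternary)) : N.-tuple ternary :=
  foldl (@superpose_tuple N) (head (nseq_tuple N None) s) (behead s).

Definition resolution N (x : N.-tuple ternary) : {set N.-tuple bool} :=
  [set y | [forall i, (tnth x i != None) ==> (tnth x i == Some (tnth y i))]].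

Definition hazard_free_ext N M (f : N.-tuple bool -> M.-tuple bool)
    (x : N.-tuple ternary) : M.-tuple ternary :=
  superposition [seq stable (f y) | y in resolution x].

Definition implements N M (C : circuit N M)
    (f : N.-tuple bool -> M.-tuple bool) : Prop :=
  forall x : N.-tuple bool, circuit_eval C (stable x) = stable (f x).

Definition hazard_free N M (k : nat) (C : circuit N M)
    (f : N.-tuple bool -> M.-tuple bool) : Prop :=
  forall x : N.-tuple ternary, count_mem None x <= k ->
    circuit_eval C x = hazard_free_ext f x.

Record mealy (Sigma Lambda : Type) := Mealy {
  state : finType;
  start : state;
  trans : state -> Sigma -> state;
  out : state -> Sigma -> Lambda
}.

Definition transcription (Sigma Lambda : Type) (T : mealy Sigma Lambda)
    (n : nat) (x : n.-tuple Sigma) : n.-tuple Lambda :=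
  [tuple out (foldl (@trans _ _ T) (start T) (take i x)) (tnth x i) | i < n].

Definition split_symbols l n (x : (l * n).-tuple bool)
    : n.-tuple (l.-tuple bool) :=
  [tuple [tuple nth false x (i * l + b) | b < l] | i < n].

Lemma size_concat m n (ys : n.-tuple (m.-tuple bool)) :
  size (flatten (map val ys)) == m * n.
Proof.
apply/eqP; rewrite -[in RHS](size_tuple ys) /=.
elim: (val ys) => [|y s IHs] /=; first by rewrite muln0.
by rewrite size_cat IHs size_tuple mulnS.
Qed.

Definition concat_symbols m n (ys : n.-tuple (m.-tuple bool))
    : (m * n).-tuple bool := Tuple (size_concat ys).

Definition bool_transcription l m (L : {set m.-tuple bool})
    (T : mealy (l.-tuple bool) {y | y \in L}) (n : nat)
    (x : (l * n).-tuple bool) : (m * n).-tuple bool :=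
  concat_symbols (map_tuple val (transcription T (split_symbols x))).

Definition kappa (k s : nat) : nat :=
  \sum_(0 <= i < (minn s (2 ^ k)).+1) 'C(s, i).

Definition lambda (m s a : nat) : nat := minn m (2 ^ (s * a)).

Definition log2 (R : realType) (x : R) : R := (ln x / ln 2)%R.

(* Main.v *)
Require Import Defs.
From HB Require Import structures.
From mathcomp Require Import all_boot all_order all_algebra.
From mathcomp Require Import reals exp.
From mathcomp Require Import zify ring lra.

Set Implicit Arguments.
Unset Strict Implicit.
Unset Printing Implicit Defensive.

Import Order.TTheory GRing.Theory Num.Theory.

(* A resolved input segment acts on states; encode it by the Boolean matrix over
   the kappa sets of at most 2^k states whose entry (B, B') says that the segment
   maps B into B'.  With at most k unstable bits, the set A of states that are
   reachable from s_0 has at most 2^k elements, so A is itself an index, and the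
   Kleene "or of ands" product of two such matrices outputs 1 through the reachable
   set whenever all resolutions do.  It outputs 0 when no resolution satisfies the
   entry, because the two segments resolve independently.  Matrices of single
   symbols come from hazard-free multiplexer trees whose lowest layers are shared
   between all entries (the factor 2^l / l); parallel prefix computation then needs
   2n products on O(log n) levels.  The output columns are one more product, which
   is skipped for the first symbol so that n = 1 costs depth O(l) only. *)

(** * Netlists *)

Definition run_gates A (f : seq A -> gate -> A) : seq A -> seq gate -> seq A :=
  foldl (fun vs g => rcons vs (f vs g)).

Lemma size_run_gates A (f : seq A -> gate -> A) vs gs :
  size (run_gates f vs gs) = size vs + size gs.
Proof. by elim: gs vs => [|g gs IHgs] vs /=; rewrite ?addn0 // IHgs size_rcons addnS. Qed.

Lemma nth_run_gates_init A (f : seq A -> gate -> A) a0 vs gs w :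
  w < size vs -> nth a0 (run_gates f vs gs) w = nth a0 vs w.
Proof.
elim: gs vs => //= g gs IHgs vs ltw.
by rewrite IHgs ?size_rcons ?nth_rcons ?ltw // ltnS ltnW.
Qed.

Lemma run_gates_cat A (f : seq A -> gate -> A) vs gs1 gs2 :
  run_gates f vs (gs1 ++ gs2) = run_gates f (run_gates f vs gs1) gs2.
Proof. exact: foldl_cat. Qed.

Section Netlists.
Variable N : nat.
Implicit Types (gs : seq gate) (F G : N.-tuple ternary -> ternary).

Definition acyclic gs := forall i, i < size gs ->
  all (fun v => v < N + i) (operands (nth (Const false) gs i)).

(** Inputs get level 0 and constant gates level 1, so the level of a wire bounds the number of gates
    on every path ending there. *)
Definition gate_level (ls : seq nat) (g : gate) : nat :=
  (\max_(v <- operands g) nth 0 ls v).+1.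

Definition levels gs := run_gates gate_level (nseq N 0) gs.
Definition values gs (x : N.-tuple ternary) := run_gates gate_value x gs.

Definition computes gs d F := exists w,
  [/\ w < N + size gs, nth 0 (levels gs) w <= d
    & forall x, nth None (values gs x) w = F x].

Definition extends gs gs' := exists gs2, gs' = gs ++ gs2.

Lemma extends_refl gs : extends gs gs.
Proof. by exists [::]; rewrite cats0. Qed.

Lemma extends_trans gs1 gs2 gs3 : extends gs1 gs2 -> extends gs2 gs3 -> extends gs1 gs3.
Proof. by move=> [u ->] [v ->]; exists (u ++ v); rewrite catA. Qed.

(** A specification for incremental construction with a gate budget. Gates are only appended, so
    every wire found earlier stays available and can be shared. *)
Definition buildable c gs (P : seq gate -> Prop) := exists gs',
  [/\ acyclic gs', extends gs gs', size gs' <= size gs + c & P gs'].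

Lemma levels_cat gs gs' w : w < N + size gs ->
  nth 0 (levels (gs ++ gs')) w = nth 0 (levels gs) w.
Proof.
by move=> ltw; rewrite /levels run_gates_cat nth_run_gates_init ?size_run_gates ?size_nseq.
Qed.

Lemma values_cat gs gs' x w : w < N + size gs ->
  nth None (values (gs ++ gs') x) w = nth None (values gs x) w.
Proof.
by move=> ltw; rewrite /values run_gates_cat nth_run_gates_init ?size_run_gates ?size_tuple.
Qed.

Lemma computes_extends gs gs' d F : extends gs gs' -> computes gs d F -> computes gs' d F.
Proof.
case=> gs2 ->{gs'} [w [ltw lew Fw]]; exists w.
by rewrite size_cat levels_cat // addnA ltn_addr //; split=> // x; rewrite values_cat.
Qed.

Lemma computes_leq gs d d' F : d <= d' -> computes gs d F -> computes gs d' F.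
Proof. by move=> led [w [ltw lew Fw]]; exists w; split=> //; apply: leq_trans led. Qed.

Lemma eq_computes gs d F G : F =1 G -> computes gs d F -> computes gs d G.
Proof. by move=> eqFG [w [? ? Fw]]; exists w; split=> // x; rewrite Fw. Qed.

Lemma computes_input gs d p : p < N -> computes gs d (fun x => nth None x p).
Proof.
move=> ltp; exists p; split; first exact: ltn_addr.
  by rewrite nth_run_gates_init ?size_nseq // nth_nseq ltp.
by move=> x; rewrite nth_run_gates_init ?size_tuple.
Qed.

(** * Combinators for building netlists within a gate budget *)

Lemma buildable_ret c gs (P : seq gate -> Prop) : acyclic gs -> P gs -> buildable c gs P.
Proof. by move=> gsP Pgs; exists gs; split=> //; [apply: extends_refl | apply: leq_addr]. Qed.

Lemma buildable_bind c1 c2 gs (P Q : seq gate -> Prop) : buildable c1 gs P ->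
    (forall gs1, acyclic gs1 -> extends gs gs1 -> P gs1 -> buildable c2 gs1 Q) ->
  buildable (c1 + c2) gs Q.
Proof.
move=> [gs1 [ac1 pre1 le1 P1]] /(_ gs1 ac1 pre1 P1) [gs2 [ac2 pre2 le2 Q2]].
exists gs2; split=> //; first exact: extends_trans pre1 pre2.
by rewrite addnA (leq_trans le2) // leq_add2r.
Qed.

Lemma buildable_leq c c' gs (P : seq gate -> Prop) :
  c <= c' -> buildable c gs P -> buildable c' gs P.
Proof.
move=> lec [gs' [? ? les ?]]; exists gs'; split=> //.
by rewrite (leq_trans les) // leq_add2l.
Qed.

Lemma buildable_imp c gs (P Q : seq gate -> Prop) :
  (forall gs', extends gs gs' -> P gs' -> Q gs') -> buildable c gs P -> buildable c gs Q.
Proof. by move=> PQ [gs' [? ? ? ?]]; exists gs'; split=> //; apply: PQ. Qed.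

(** Stability of [Q] under extension keeps what was built for earlier indices valid while later ones
    are added. *)
Lemma buildable_all (I : eqType) (s : seq I) c gs (Q : I -> seq gate -> Prop) :
    acyclic gs ->
    (forall i gs1 gs2, extends gs1 gs2 -> Q i gs1 -> Q i gs2) ->
    (forall i gs1, i \in s -> acyclic gs1 -> extends gs gs1 -> buildable c gs1 (Q i)) ->
  buildable (size s * c) gs (fun gs' => forall i, i \in s -> Q i gs').
Proof.
move=> ac Qpre; elim: s gs ac => [|i s IHs] gs ac bQ; first exact: buildable_ret.
rewrite mulSn; apply: buildable_bind (bQ i gs (mem_head _ _) ac (extends_refl _)) _.
move=> gs1 ac1 pre1 Q1; apply: buildable_imp (IHs gs1 ac1 _) => [gs2 pre2 Q2 j|].
  by rewrite inE => /predU1P[-> | /Q2//]; apply: Qpre Q1.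
move=> j gs2 sj ac2 pre2; apply: bQ => //; first by rewrite inE sj orbT.
exact: extends_trans pre1 pre2.
Qed.

Lemma buildable_gate gs g d F : acyclic gs ->
    all (fun v => (v < N + size gs) && (nth 0 (levels gs) v <= d)) (operands g) ->
    (forall x, gate_value (values gs x) g = F x) ->
  buildable 1 gs (fun gs' => computes gs' d.+1 F).
Proof.
move=> ac /allP g_ok gF; exists (rcons gs g); split.
- move=> i; rewrite size_rcons ltnS leq_eqVlt nth_rcons => /predU1P[-> | lti].
    by rewrite ltnn eqxx; apply/allP=> v /g_ok/andP[].
  by rewrite lti ac.
- by exists [:: g]; rewrite cats1.
- by rewrite size_rcons addn1.
exists (N + size gs); rewrite -cats1 size_cat addnA addn1 ltnSn.
rewrite /levels /values !run_gates_cat /= nth_rcons size_run_gates size_nseq ltnn eqxx.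
split=> // [|x]; first by rewrite ltnS; apply/bigmax_leqP_seq => v /g_ok/andP[].
by rewrite run_gates_cat /= nth_rcons size_run_gates size_tuple ltnn eqxx -gF.
Qed.

Lemma buildable_and gs d F G : acyclic gs -> computes gs d F -> computes gs d G ->
  buildable 1 gs (fun gs' => computes gs' d.+1 (fun x => kleene_and (F x) (G x))).
Proof.
move=> ac [v [ltv lev Fv]] [w [ltw lew Gw]].
by apply: (buildable_gate (g := And v w) ac) => [|x] /=; rewrite ?ltv ?lev ?ltw ?lew // Fv Gw.
Qed.

Lemma buildable_or gs d F G : acyclic gs -> computes gs d F -> computes gs d G ->
  buildable 1 gs (fun gs' => computes gs' d.+1 (fun x => kleene_or (F x) (G x))).
Proof.
move=> ac [v [ltv lev Fv]] [w [ltw lew Gw]].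
by apply: (buildable_gate (g := Or v w) ac) => [|x] /=; rewrite ?ltv ?lev ?ltw ?lew // Fv Gw.
Qed.

Lemma buildable_not gs d F : acyclic gs -> computes gs d F ->
  buildable 1 gs (fun gs' => computes gs' d.+1 (fun x => kleene_not (F x))).
Proof.
move=> ac [v [ltv lev Fv]].
by apply: (buildable_gate (g := Not v) ac) => [|x] /=; rewrite ?ltv ?lev // Fv.
Qed.

Lemma buildable_const gs d b : acyclic gs ->
  buildable 1 gs (fun gs' => computes gs' d.+1 (fun=> Some b)).
Proof. by move=> ac; apply: (buildable_gate (g := Const b)). Qed.

(** The gate driving [w] is appended when the levels of all its operands are final. Beyond the list,
    the default gate is a constant without operands. *)
Lemma level_operand gs v w : acyclic gs -> N <= w ->
    v \in operands (nth (Const false) gs (w - N)) ->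
  nth 0 (levels gs) v < nth 0 (levels gs) w.
Proof.
move=> ac leNw; case: (ltnP (w - N) (size gs)) => [ltw | /(nth_default _)->//] opv.
have ltv: v < w by have /allP/(_ v opv) := ac _ ltw; rewrite subnKC.
have defgs := cat_take_drop (w - N).+1 gs; rewrite -defgs.
have szt: size (take (w - N).+1 gs) = (w - N).+1 by rewrite size_takel.
rewrite !levels_cat ?szt ?addnS ?subnKC // ?ltnS //; last exact: ltnW.
rewrite (take_nth (Const false)) // -cats1.
have szt': size (take (w - N) gs) = w - N by rewrite size_takel // ltnW.
rewrite levels_cat ?szt' ?subnKC //.
rewrite /levels run_gates_cat /= nth_rcons size_run_gates size_nseq szt' subnKC //.
rewrite ltnn eqxx ltnS /gate_level.
exact: (@leq_bigmax_seq _ _ xpredT (nth 0 _)).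
Qed.

Lemma circuit_of_netlist M gs d (Fs : 'I_M -> N.-tuple ternary -> ternary) :
  acyclic gs -> (forall j, computes gs d (Fs j)) -> exists C : circuit N M,
  [/\ circuit_size C = size gs, circuit_depth C <= d
    & forall x j, tnth (circuit_eval C x) j = Fs j x].
Proof.
move=> ac /fin_all_exists[w wP].
have outs_ok: all (fun v => v < N + size gs) [tuple w j | j < M].
  by apply/allP=> _ /mapP[j _ ->]; case: (wP j).
exists (Circuit ac outs_ok); split=> // [|x j].
  apply/bigmax_leqP => -[d' /= _] /existsP[v /existsP[p /andP[vp]]].
  case/mapP=> j _; set q := map val p in vp *; move=> last_w.
  have <-: size q = d' by rewrite size_map size_tuple.
  have [_ + _] := wP j; rewrite -last_w; apply: leq_trans; move: vp.
  (* Levels increase strictly along the path, so its length is at most the level of its last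
     wire. *)
  elim/last_ind: (q) => // q' u IHq; rewrite rcons_path size_rcons last_rcons.
  case/andP=> /IHq leq' /andP[leNu opu]; apply: leq_ltn_trans leq' _.
  exact: level_operand.
by have [_ _ wF] := wP j; rewrite tnth_mktuple /= tnth_mktuple -wF.
Qed.

End Netlists.

(** * Multiplexer trees and prefix circuits *)

(** The iterated Kleene [or], defined without reference to order or bracketing, so that an or-tree
    of any shape computes it. *)
Definition kleene_any (s : seq ternary) : ternary :=
  if Some true \in s then Some true
  else if all (pred1 (Some false)) s then Some false else None.

Lemma kleene_any_cat s1 s2 :
  kleene_any (s1 ++ s2) = kleene_or (kleene_any s1) (kleene_any s2).
Proof.
rewrite /kleene_any mem_cat all_cat.
by do 2![case: (_ \in _)]; do 2![case: (all _ _)].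
Qed.

Lemma kleene_any_true s : (kleene_any s == Some true) = (Some true \in s).
Proof. by rewrite /kleene_any; case: ifP => // _; case: ifP. Qed.

Lemma kleene_any_false s : (kleene_any s == Some false) = all (pred1 (Some false)) s.
Proof.
rewrite /kleene_any; case: ifP => [st | _]; last by case: ifP.
by apply/esym/negP => /allP/(_ _ st).
Qed.

Lemma kleene_and_false a b :
  (kleene_and a b == Some false) = (a == Some false) || (b == Some false).
Proof. by case: a b => [[]|] [[]|]. Qed.

Lemma kleene_and_true a b :
  (kleene_and a b == Some true) = (a == Some true) && (b == Some true).
Proof. by case: a b => [[]|] [[]|]. Qed.

(* The consensus term [and p q] is what makes the multiplexer hazard-free. *)
Definition mux (a p q : ternary) : ternary :=
  kleene_or (kleene_or (kleene_and (kleene_not a) p) (kleene_and a q)) (kleene_and p q).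

Lemma mux_Some (a : bool) p q : mux (Some a) p q = if a then q else p.
Proof. by case: a p q => [] [[]|] [[]|]. Qed.

Lemma mux_None p q b : (mux None p q == Some b) = (p == Some b) && (q == Some b).
Proof. by case: p q b => [[]|] [[]|] []. Qed.

(** * Resolutions and multiplexer trees *)

Lemma resolutionP N (x : N.-tuple ternary) (y : N.-tuple bool) :
  reflect (forall i : 'I_N, tnth x i != None -> tnth x i = Some (tnth y i))
          (y \in resolution x).
Proof.
rewrite inE; apply: (iffP forallP) => h i.
  by have /implyP/[apply]/eqP := h i.
by apply/implyP=> /h ->.
Qed.

Definition splice N (c : nat) (y0 y : N.-tuple bool) : N.-tuple bool :=
  [tuple if i < c then tnth y0 i else tnth y i | i < N].

(** Resolution constrains each bit separately, so two resolutions of one input can be cut and glued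
    at any position. *)
Lemma splice_resolution N c (x : N.-tuple ternary) (y0 y : N.-tuple bool) :
  y0 \in resolution x -> y \in resolution x -> splice c y0 y \in resolution x.
Proof.
move=> /resolutionP y0P /resolutionP yP; apply/resolutionP => i xi.
by rewrite tnth_mktuple; case: ifP => _; [apply: y0P | apply: yP].
Qed.

Lemma nth_splice_lt N c (y0 y : N.-tuple bool) p :
  p < c -> nth false (splice c y0 y) p = nth false y0 p.
Proof.
move=> ltpc; have [ltp | lep] := ltnP p N; last by rewrite !nth_default ?size_tuple.
by rewrite -[p]/(val (Ordinal ltp)) -!tnth_nth tnth_mktuple ltpc.
Qed.

Lemma nth_splice_ge N c (y0 y : N.-tuple bool) p :
  c <= p -> nth false (splice c y0 y) p = nth false y p.
Proof.
rewrite leqNgt => /negPf gepc; have [ltp | lep] := ltnP p N; last by rewrite !nth_default ?size_tuple.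
by rewrite -[p]/(val (Ordinal ltp)) -!tnth_nth tnth_mktuple gepc.
Qed.

Fixpoint mux_tree N (g : seq bool -> bool) (ps : seq nat) (x : N.-tuple ternary) : ternary :=
  if ps is p :: ps' then
    mux (nth None x p) (mux_tree (g \o cons false) ps' x) (mux_tree (g \o cons true) ps' x)
  else Some (g [::]).

Lemma eq_mux_tree N g h (ps : seq nat) (x : N.-tuple ternary) :
  (forall ys, size ys = size ps -> g ys = h ys) -> mux_tree g ps x = mux_tree h ps x.
Proof.
elim: ps g h => [|p ps IHps] g h eqgh /=; first by rewrite eqgh.
by congr mux; apply: IHps => ys szys; apply: eqgh; rewrite /= szys.
Qed.

Definition bits N (ps : seq nat) (y : N.-tuple bool) : seq bool := map (nth false y) ps.

(** The tree is exact for any number of unstable bits. A stable root selects a subtree; an unstable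
    root yields [b] exactly when both subtrees do, and since positions do not repeat, the root bit
    resolves independently of the rest. *)
Lemma mux_tree_spec N g (ps : seq nat) (x : N.-tuple ternary) b :
    uniq ps -> all (fun p => p < N) ps ->
  (mux_tree g ps x == Some b) = [forall y in resolution x, g (bits ps y) == b].
Proof.
elim: ps g => [|p ps IHps] g /=.
  move=> _ _; apply/eqP/forall_inP => [[<-]//| h].
  (* Some resolution exists: set every unstable bit to 0. *)
  suffices y0P: [tuple odflt false (tnth x i) | i < N] \in resolution x.
    by rewrite (eqP (h _ y0P)).
  by apply/resolutionP => i; rewrite tnth_mktuple; case: (tnth x i).
case/andP=> nps ups /andP[ltp allps]; set i := Ordinal ltp.
have xE: nth None x p = tnth x i by rewrite (tnth_nth None).
have yE (y : N.-tuple bool) : nth false y p = tnth y i by rewrite (tnth_nth false).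
rewrite xE; case xi: (tnth x i) => [a|].
  rewrite mux_Some -(fun_if (fun f => f _ _)) -(fun_if (fun g => mux_tree g)) /=.
  rewrite (_ : (if a then g \o cons true else g \o cons false) = g \o cons a); last by case: (a).
  rewrite IHps //; apply: eq_forallb_in => y /resolutionP/(_ i).
  by rewrite xi yE => /(_ isT)[<-].
rewrite mux_None !IHps //; apply/andP/forall_inP => [[/forall_inP h0 /forall_inP h1] y yx | h].
  by rewrite yE; case: (tnth y i); [apply: h1 | apply: h0].
suffices set_bit a: [forall y in resolution x, (g \o cons a) (bits ps y) == b] by [].
apply/forall_inP => y /resolutionP yx.
(* The root bit is unstable, so overwriting it by [a] gives another resolution. *)
pose y' := [tuple if j == i then a else tnth y j | j < N].
have y'x: y' \in resolution x.
  by apply/resolutionP => j; rewrite tnth_mktuple; case: (j =P i) => [->|_ /yx//]; rewrite xi.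
have := h _ y'x; rewrite yE tnth_mktuple eqxx /= => /eqP <-; apply/eqP; congr (g (_ :: _)).
apply/eq_in_map => q qps; have ltq: q < N by apply: (allP allps).
rewrite -[q]/(val (Ordinal ltq)) -!tnth_nth tnth_mktuple -val_eqE /=.
by case: (q =P p) => // eqpq; rewrite -eqpq qps in nps.
Qed.

(** * Building families of functions gate by gate *)

Section Families.
Variable N : nat.
Implicit Types (gs : seq gate) (F G : N.-tuple ternary -> ternary).

Lemma buildable_mux gs d p F G : acyclic N gs -> p < N -> computes gs d F -> computes gs d G ->
  buildable N 6 gs (fun gs' => computes gs' (4 + d) (fun x => mux (nth None x p) (F x) (G x))).
Proof.
move=> ac ltp hF hG; rewrite -[6]/(1 + (1 + (1 + (1 + (1 + 1))))).
have ext := computes_extends; have hx gs' : computes gs' d (fun x : N.-tuple ternary => nth None x p).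
  exact: computes_input.
apply: buildable_bind (buildable_not ac (hx _)) _ => gs1 ac1 pre1 h1.
apply: buildable_bind (buildable_and ac1 h1 (computes_leq (leqnSn d) (ext _ _ _ _ _ pre1 hF))) _.
move=> gs2 ac2 pre2 h2.
apply: buildable_bind (buildable_and (d := d.+1) ac2 (computes_leq (leqnSn d) (hx _))
  (computes_leq (leqnSn d) (ext _ _ _ _ _ (extends_trans pre1 pre2) hG))) _.
move=> gs3 ac3 pre3 h3.
apply: buildable_bind (buildable_or ac3 (ext _ _ _ _ _ pre3 h2) h3) _ => gs4 ac4 pre4 h4.
have pre := extends_trans pre1 (extends_trans pre2 (extends_trans pre3 pre4)).
have leq2 : d <= d.+2 by rewrite -addn2 leq_addr.
apply: buildable_bind (buildable_and (d := d.+2) ac4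
  (computes_leq leq2 (ext _ _ _ _ _ pre hF)) (computes_leq leq2 (ext _ _ _ _ _ pre hG))) _.
move=> gs5 ac5 pre5 h5.
exact: buildable_or (ext _ _ _ _ _ pre5 h4) h5.
Qed.

(** Functions on [seq bool] are infinitely many; truth tables give a finite type to enumerate, and
    agree with them on the lists that a tree reads. *)
Definition truth_table r (f : {ffun r.-tuple bool -> bool}) (ys : seq bool) : bool :=
  f [tuple nth false ys i | i < r].

Lemma truth_tableE r (g : seq bool -> bool) ys :
  size ys = r -> truth_table [ffun t : r.-tuple bool => g t] ys = g ys.
Proof.
move=> szys; rewrite /truth_table ffunE; congr (g _).
apply: (@eq_from_nth _ false); rewrite ?size_tuple // => i lti.
by rewrite -[i]/(val (Ordinal lti)) -tnth_nth tnth_mktuple.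
Qed.

(** Each function of [p :: ps] is one multiplexer over two functions of [ps], all of which are
    already built. *)
Lemma buildable_all_functions gs (ps : seq nat) :
    acyclic N gs -> all (fun p => p < N) ps ->
  buildable N (12 * 2 ^ (2 ^ size ps)) gs
    (fun gs' => forall g, computes gs' (4 * size ps + 1) (@mux_tree N g ps)).
Proof.
move=> ac; elim: ps => [|p ps IHps] /=.
  move=> _; have b2: buildable N 2 gs (fun gs' => forall b : bool, b \in [:: false; true] ->
      computes gs' 1 (fun _ : N.-tuple ternary => Some b)).
    rewrite -[2]/(size [:: false; true] * 1); apply: buildable_all => // [b gs1 gs2|b gs1 _ ac1 _].
      exact: computes_extends.
    exact: buildable_const.
  apply: buildable_leq (buildable_imp _ b2) => //= gs' _ h g.
  by apply: (h (g [::])); case: (g _).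
case/andP=> ltp /IHps b1.
pose fs := enum [set: {ffun (size ps).+1.-tuple bool -> bool}].
have szfs: size fs = 2 ^ (2 ^ (size ps).+1).
  by rewrite -cardE cardsT card_ffun card_tuple card_bool.
(* With [a = 2 ^ (2 ^ size ps)] this is [12 a + 6 a^2 <= 12 a^2], which holds because [a >= 2]. *)
have le_c: 12 * 2 ^ (2 ^ size ps) + size fs * 6 <= 12 * 2 ^ (2 ^ (size ps).+1).
  rewrite szfs (mulnC _ 6) expnS mul2n -addnn expnD.
  have : 2 <= 2 ^ (2 ^ size ps) by rewrite -{1}(expn1 2) leq_exp2l // expn_gt0.
  by nia.
apply: buildable_leq le_c _; apply: buildable_bind b1 _ => gs1 ac1 pre1 h1.
pose Q (f : {ffun (size ps).+1.-tuple bool -> bool}) gs' :=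
  computes gs' (4 * (size ps).+1 + 1) (@mux_tree N (truth_table f) (p :: ps)).
have ball: buildable N (size fs * 6) gs1 (fun gs' => forall f, f \in fs -> Q f gs').
  apply: buildable_all => // [f gs2 gs3|f gs2 _ ac2 pre2]; first exact: computes_extends.
  rewrite /Q mulnS -addnA.
  by apply: buildable_mux => //; apply: (computes_extends pre2).
apply: buildable_imp ball => gs2 _ h g.
have := h [ffun t : (size ps).+1.-tuple bool => g t]; rewrite mem_enum inE => /(_ isT).
apply: eq_computes => x; apply: eq_mux_tree => ys szys; exact: truth_tableE.
Qed.

(** Only the upper layers over [ps] are paid for; the leaves are functions of [qs] that already have
    wires. *)
Lemma buildable_mux_tree gs d (ps qs : seq nat) :
    acyclic N gs -> all (fun p => p < N) ps ->
    (forall g, computes gs d (@mux_tree N g qs)) ->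
  forall g, buildable N (6 * (2 ^ size ps).-1) gs
    (fun gs' => computes gs' (4 * size ps + d) (@mux_tree N g (ps ++ qs))).
Proof.
move=> ac allp hqs g.
elim: ps gs g ac allp hqs => [|p ps IHps] gs g ac /=; first by move=> _ h; apply: buildable_ret.
case/andP=> ltp allp hqs.
have -> : 6 * (2 ^ (size ps).+1).-1 =
          6 * (2 ^ size ps).-1 + (6 * (2 ^ size ps).-1 + 6).
  have := expn_gt0 2 (size ps); rewrite expnS; lia.
apply: buildable_bind (IHps gs (g \o cons false) ac allp hqs) _ => gs1 ac1 pre1 h1.
apply: buildable_bind (IHps gs1 (g \o cons true) ac1 allp (fun g => computes_extends pre1 (hqs g))) _.
move=> gs2 ac2 pre2 h2; rewrite mulnS -addnA.
exact: buildable_mux ac2 ltp (computes_extends pre2 h1) h2.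
Qed.

Lemma buildable_any gs d h (Fs : seq (N.-tuple ternary -> ternary)) :
    acyclic N gs -> 0 < size Fs <= 2 ^ h -> List.Forall (computes gs d) Fs ->
  buildable N (size Fs).-1 gs
    (fun gs' => computes gs' (h + d) (fun x => kleene_any [seq F x | F <- Fs])).
Proof.
elim: h gs Fs => [|h IHh] gs Fs ac.
  case: Fs => [|F [|G Fs]] //= _ hF; apply: buildable_ret => //.
  apply: eq_computes (List.Forall_inv hF) => x.
  by rewrite /kleene_any inE /= andbT; case: (F x) => [[]|].
case/andP=> Fs0 leF hFs; have [le_h | gt_h] := leqP (size Fs) (2 ^ h).
  apply: buildable_imp (IHh gs Fs ac _ hFs); last by rewrite Fs0.
  by move=> gs' _; apply: computes_leq; rewrite leq_add2r.
(* Balanced or-tree: a full half of [2 ^ h] terms, the remainder, and one more [Or]. *)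
rewrite -(cat_take_drop (2 ^ h) Fs) in hFs *.
have /List.Forall_app[h1 h2] := hFs.
have sz1: size (take (2 ^ h) Fs) = 2 ^ h by rewrite size_takel // ltnW.
have sz2: 0 < size (drop (2 ^ h) Fs) <= 2 ^ h.
  by rewrite size_drop subn_gt0 gt_h leq_subLR addnn -mul2n -expnS.
have -> : (size (take (2 ^ h) Fs ++ drop (2 ^ h) Fs)).-1 =
    (size (take (2 ^ h) Fs)).-1 + ((size (drop (2 ^ h) Fs)).-1 + 1).
  by rewrite size_cat; have := expn_gt0 2 h; move: sz1 sz2; lia.
have b1 := IHh gs _ ac _ h1; rewrite sz1 leqnn expn_gt0 in b1 *.
apply: buildable_bind (b1 isT) _ => gs1 ac1 pre1 has1.
apply: buildable_bind (IHh gs1 _ ac1 sz2 _) _ => [|gs2 ac2 pre2 has2].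
  by apply: List.Forall_impl h2 => F; apply: computes_extends.
apply: buildable_imp (buildable_or ac2 (computes_extends pre2 has1) has2) => gs3 _.
by apply: eq_computes => x; rewrite map_cat kleene_any_cat.
Qed.

(** This is one entry of a Kleene matrix product: a row of [And] gates below a balanced or-tree. *)
Lemma buildable_any_and (K : finType) gs d (F G : K -> N.-tuple ternary -> ternary) :
    0 < #|K| -> acyclic N gs -> (forall B, computes gs d (F B)) -> (forall B, computes gs d (G B)) ->
  buildable N (2 * #|K|) gs (fun gs' => computes gs' (up_log 2 #|K| + d.+1)
    (fun x => kleene_any [seq kleene_and (F B x) (G B x) | B <- enum K])).
Proof.
move=> K0 ac hF hG; rewrite mul2n -addnn cardE.
have ball: buildable N (size (enum K) * 1) gs (fun gs' => forall B, B \in enum K ->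
    computes gs' d.+1 (fun x => kleene_and (F B x) (G B x))).
  apply: buildable_all => // [B gs1 gs2|B gs1 _ ac1 pre1]; first exact: computes_extends.
  by apply: buildable_and => //; apply: (computes_extends pre1).
rewrite muln1 in ball; apply: buildable_bind ball _ => gs1 ac1 pre1 h1.
pose Fs := [seq (fun x => kleene_and (F B x) (G B x)) | B <- enum K].
have szFs: size Fs = size (enum K) by rewrite size_map.
apply: (@buildable_leq _ (size Fs).-1); first by rewrite szFs leq_pred.
rewrite -szFs; apply: buildable_imp (buildable_any (h := up_log 2 (size Fs)) ac1 _ _) => [gs2 _||].
- by apply: eq_computes => x; rewrite -map_comp.
- by rewrite szFs -cardE K0 up_logP.
have {h1}: forall B, computes gs1 d.+1 (fun x => kleene_and (F B x) (G B x)).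
  by move=> B; apply: h1; rewrite mem_enum.
by rewrite /Fs => h1; elim: (enum K) => [|B s IHs] /=; constructor.
Qed.

(* Pairing neighbours halves the number of factors; the prefixes of the halved
   sequence are every other prefix of the original one. *)
Lemma buildable_prefixes (H : seq gate -> nat -> nat -> nat -> Prop) c D :
    (forall gs gs' d a b, extends gs gs' -> H gs d a b -> H gs' d a b) ->
    (forall gs d d' a b, d <= d' -> H gs d a b -> H gs d' a b) ->
    (forall gs d a b e, acyclic N gs -> H gs d a b -> H gs d b e ->
       buildable N c gs (fun gs' => H gs' (D + d) a e)) ->
  forall n p gs d, 0 < n -> acyclic N gs -> (forall i, i < n -> H gs d (p i) (p i.+1)) ->
  buildable N (n * 2 * c) gs
    (fun gs' => forall i, i < n -> H gs' (2 * trunc_log 2 n * D + d) (p 0) (p i.+1)).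
Proof.
move=> Hext Hleq Hmul n; elim/ltn_ind: n => n IHn p gs d n0 ac Hp.
have [-> | n1] := eqVneq n 1.
  apply: buildable_ret => // i; rewrite ltnS leqn0 => /eqP->.
  exact: (Hleq _ _ _ _ _ (leq_addl _ _) (Hp 0 n0)).
pose h := n./2; have h0: 0 < h by rewrite /h; lia.
have lehn: h < n by rewrite /h; lia.
have logn: trunc_log 2 n = (trunc_log 2 h).+1 by rewrite trunc_log2S // ltn_neqAle eq_sym n1.
apply: (@buildable_leq _ (h * c + (h * 2 * c + n.-1./2 * c))).
  have : h + (h * 2 + n.-1./2) <= n * 2 by rewrite /h; lia.
  by rewrite -!mulnDl leq_mul2r => ->; rewrite orbT.
(* Products of neighbouring factors; an unpaired last factor is left for the final stage. *)
have ball: buildable N (size (iota 0 h) * c) gs (fun gs' => forall i, i \in iota 0 h ->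
    H gs' (D + d) (p i.*2) (p i.+1.*2)).
  apply: buildable_all => // [i gs1 gs2|i gs1]; first exact: Hext.
  rewrite mem_iota add0n => /andP[_ lti] ac1 pre1.
  by apply: Hmul => //; apply: (Hext _ _ _ _ _ pre1); apply: Hp; lia.
rewrite size_iota in ball; apply: buildable_bind ball _ => gs1 ac1 pre1 h1.
have {}h1 i : i < h -> H gs1 (D + d) (p i.*2) (p i.+1.*2).
  by move=> lti; apply: h1; rewrite mem_iota.
apply: buildable_bind (IHn h lehn (p \o double) gs1 (D + d) h0 ac1 h1) _.
move=> gs2 ac2 pre2; rewrite /= => h2; set d2 := (2 * _ * D + _) in h2.
have led2: d <= d2 by rewrite /d2; lia.
have ->: 2 * trunc_log 2 n * D + d = D + d2 by rewrite logn /d2 mulnS !mulnDl; lia.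
(* The missing prefixes of odd length at least 3: an even prefix times one original factor. Together
   with the pairing this costs depth [2 * D] per halving. *)
have ball: buildable N (size (iota 0 n.-1./2) * c) gs2 (fun gs' =>
    forall i, i \in iota 0 n.-1./2 -> H gs' (D + d2) (p 0) (p i.+1.*2.+1)).
  apply: buildable_all => // [i gs3 gs4|i gs3]; first exact: Hext.
  rewrite mem_iota add0n => /andP[_ lti] ac3 pre3.
  apply: (Hmul _ _ _ (p i.+1.*2)) => //; apply: (Hext _ _ _ _ _ pre3).
    by apply: h2; rewrite /h; lia.
  by apply: (Hext _ _ _ _ _ pre2); apply: (Hext _ _ _ _ _ pre1); apply: (Hleq _ _ _ _ _ led2); apply: Hp; lia.
rewrite size_iota in ball; apply: buildable_imp ball => gs3 pre3 h3 i lti.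
case: (posnP i) => [-> | i0].
  apply: (Hext _ _ _ _ _ pre3); apply: (Hext _ _ _ _ _ pre2); apply: (Hext _ _ _ _ _ pre1).
  by apply: (Hleq _ _ _ _ _ _ (Hp 0 n0)); lia.
have [oi | ei] := boolP (odd i).
  have -> : i.+1 = i./2.+1.*2 by lia.
  by apply: (Hext _ _ _ _ _ pre3); apply: (Hleq _ _ _ _ _ (leq_addl _ _)); apply: h2; rewrite /h; lia.
have -> : i = (i./2.-1).+1.*2 by lia.
by apply: h3; rewrite mem_iota; lia.
Qed.

End Families.

(** * Transition matrices *)

Section Runs.
Variables (S : finType) (l n k : nat) (trans : S -> l.-tuple bool -> S).
Implicit Types (x : (l * n).-tuple ternary) (y : (l * n).-tuple bool) (B : {set S}).

Definition symbol y (i : nat) : l.-tuple bool := [tuple nth false y (i * l + b) | b < l].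

Definition run y a b s := foldl (fun s i => trans s (symbol y i)) s (iota a (b - a)).

Lemma run_cat y a b c s : a <= b <= c -> run y a c s = run y b c (run y a b s).
Proof.
case/andP=> leab lebc; rewrite /run -foldl_cat; congr foldl.
by rewrite -[in iota b _](subnKC leab) -iotaD; congr iota; lia.
Qed.

Lemma eq_symbol y y' i :
  (forall p, i * l <= p < i.+1 * l -> nth false y p = nth false y' p) -> symbol y i = symbol y' i.
Proof.
move=> eqy; apply: eq_from_tnth => b; rewrite !tnth_mktuple; apply: eqy.
by rewrite leq_addr mulSn addnC ltn_add2r ltn_ord.
Qed.

Lemma eq_run y y' a b s :
  (forall p, a * l <= p < b * l -> nth false y p = nth false y' p) -> run y a b s = run y' a b s.
Proof.
move=> eqy; rewrite /run.
have: all (fun i => a <= i < b) (iota a (b - a)).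
  by apply/allP => i; rewrite mem_iota; lia.
elim: (iota _ _) s => //= i r IHr s /andP[/andP[leai ltib] /IHr->]; congr foldl.
rewrite (@eq_symbol y y') // => p /andP[lep ltp]; apply: eqy.
rewrite (leq_trans _ lep) ?leq_mul2r ?leai ?orbT // (leq_trans ltp) //.
by rewrite leq_mul2r ltib orbT.
Qed.

(** * Unstable bits and reachable sets of states *)

Definition unstable a b x : nat :=
  #|[set i : 'I_(l * n) | (tnth x i == None) && (a * l <= i < b * l)]|.

Lemma unstable_add a b c x : a <= b <= c -> unstable a b x + unstable b c x <= unstable a c x.
Proof.
case/andP=> leab lebc.
have leabl: a * l <= b * l by rewrite leq_mul2r leab orbT.
have lebcl: b * l <= c * l by rewrite leq_mul2r lebc orbT.
rewrite /unstable; set A := [set i | _]; set B := [set i | _].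
have AB0: A :&: B = set0.
  by apply/setP => i; rewrite !inE; case: (tnth x i == None) => //=; lia.
rewrite -cardsUI AB0 cards0 addn0; apply: subset_leq_card; apply/subsetP => i.
by rewrite !inE; case: (tnth x i == None) => //=; lia.
Qed.

Lemma unstable_count b x : unstable 0 b x <= count_mem None x.
Proof.
have -> : count_mem None x = #|[set i | tnth x i == None]|.
  by rewrite -sum1_count big_mkcond big_tuple -big_mkcond sum1dep_card cardsE.
by apply: subset_leq_card; apply/subsetP => i; rewrite !inE => /andP[].
Qed.

Definition reach a b x B : {set S} :=
  [set run ys.1 a b ys.2 | ys in setX (resolution x) B].

(* A run over [a, b) depends only on its start and on which unstable bits of
   that segment resolve to 1. *)
Lemma card_reach a b x B : #|reach a b x B| <= #|B| * 2 ^ unstable a b x.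
Proof.
set U := [set i : 'I_(l * n) | (tnth x i == None) && (a * l <= i < b * l)].
pose fill (D : {set 'I_(l * n)}) : (l * n).-tuple bool :=
  [tuple if tnth x i is Some v then v else i \in D | i < l * n].
rewrite mulnC -card_powerset -cardsX.
apply: leq_trans (leq_imset_card (fun Ds => run (fill Ds.1) a b Ds.2) _).
apply: subset_leq_card; apply/subsetP => _ /imsetP[[y s] /setXP[/= yx sB] ->].
(* The subset records where [y] resolves an unstable bit of the segment to 1. *)
apply/imsetP; exists ([set i in U | tnth y i], s).
  by rewrite !inE sB andbT /=; apply/subsetP => i; rewrite !inE => /andP[].
apply: eq_run => p seg_p; have [ltp | lep] := ltnP p (l * n); last by rewrite !nth_default ?size_tuple.
rewrite -[p]/(val (Ordinal ltp)) -!tnth_nth tnth_mktuple !inE /= seg_p andbT.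
have := resolutionP _ _ yx (Ordinal ltp).
by case: (tnth x _) => [v /(_ isT)[]|].
Qed.

(* [F] is the value at [x] of a wire meant to carry "phi y s holds for all s in
   B", where [y] is the input.  The value 0 is exact and the value 1 is
   sound; completeness of 1 is only required when [w], the number of unstable
   bits read by [phi], cannot enlarge [B] beyond 2 ^ k states. *)
Definition entry x w B (phi : (l * n).-tuple bool -> S -> bool) (F : ternary) :=
  [/\ (F == Some false) = [forall y in resolution x, ~~ [forall s in B, phi y s]],
      F == Some true -> {in resolution x, forall y, {in B, forall s, phi y s}}
    & #|B| * 2 ^ w <= 2 ^ k ->
      {in resolution x, forall y, {in B, forall s, phi y s}} -> F == Some true].

Definition small := {B : {set S} | #|B| <= 2 ^ k}.

Lemma card_small : #|{: small}| = kappa k #|S|.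
Proof.
rewrite card_sig /kappa.
set M := minn _ _.
(* No set exceeds [#|S|], so the bound [2 ^ k] may be lowered to the minimum, which is the upper
   limit of the sum in [kappa]. *)
transitivity #|[set B : {set S} | #|B| <= M]|.
  by apply: eq_card => B; rewrite !inE leq_min max_card.
rewrite -sum1_card big_mkord.
rewrite (partition_big (fun B : {set S} => inord #|B| : 'I_M.+1) xpredT) //=.
apply: eq_bigr => i _; rewrite -card_draws sum1dep_card; apply: eq_card => B.
rewrite !inE; apply/andP/eqP => [[leB /eqP <-]|cardB]; first by rewrite inordK.
by rewrite cardB -ltnS ltn_ord; split=> //; apply/eqP/val_inj; rewrite /= inordK.
Qed.

(* A witness for the output 1 is the set of states reached from [B] over [a, b).
   For the output 0, segments that fail separately are glued by [splice]. *)
Lemma entry_compose x a b w B (phi : (l * n).-tuple bool -> S -> bool) (F G : small -> ternary) :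
    a <= b -> #|B| <= 2 ^ k ->
    (forall y y' s, (forall p, b * l <= p -> nth false y p = nth false y' p) ->
       phi y s = phi y' s) ->
    (forall K2 : small, entry x (unstable a b x) B (fun y s => run y a b s \in val K2) (F K2)) ->
    (forall K2 : small, entry x w (val K2) phi (G K2)) ->
  entry x (unstable a b x + w) B (fun y s => phi y (run y a b s))
    (kleene_any [seq kleene_and (F K2) (G K2) | K2 <- enum {: small}]).
Proof.
move=> leab leB phi_loc hF hG; set Fs := map _ _.
(* The run reads only bits before [b * l] and [phi] only later ones, so the glued input behaves as
   [y0] and then as [y]. *)
have spliced y0 y s : phi (splice (b * l) y0 y) (run (splice (b * l) y0 y) a b s)
    = phi y (run y0 a b s).
  rewrite (@phi_loc _ y) => [|p lep]; last exact: nth_splice_ge.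
  by congr phi; apply: eq_run => p /andP[_ ltp]; apply: nth_splice_lt.
have any_true :
    (kleene_any Fs == Some true) = [exists K2 : small, (F K2 == Some true) && (G K2 == Some true)].
  rewrite kleene_any_true; apply/mapP/existsP => [[K2 _ /esym/eqP]|[K2]].
    by rewrite kleene_and_true; exists K2.
  by rewrite -kleene_and_true => /eqP/esym; exists K2; rewrite ?mem_enum.
have any_false :
    (kleene_any Fs == Some false) = [forall K2 : small, (F K2 == Some false) || (G K2 == Some false)].
  rewrite kleene_any_false all_map; apply/allP/forallP => [h K2|h K2 _] /=.
    by rewrite -kleene_and_false; apply: h; rewrite mem_enum.
  by rewrite kleene_and_false.
split.
- rewrite any_false; apply/forallP/forall_inP => [h y yx | h K2].
    (* For a single resolution [y], the image of [B] is no larger than [B], hence an admissible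
       index; neither factor is 0 there. *)
    apply/negP => /forall_inP phi_y; pose R := [set run y a b s | s in B].
    have leR: #|R| <= 2 ^ k by apply: leq_trans leB; apply: leq_imset_card.
    have := h (exist _ R leR); have [-> _ _] := hF (exist _ R leR).
    have [-> _ _] := hG (exist _ R leR); case/orP=> /forall_inP/(_ y yx)/negP[].
      by apply/forall_inP => s sB; apply: imset_f.
    by apply/forall_inP => _ /imsetP[s sB ->]; apply: phi_y.
  have [-> _ _] := hF K2; have [-> _ _] := hG K2.
  case: forall_inP => //= notF; apply/forall_inP => y yx; apply/negP => /forall_inP phi_y.
  (* If neither factor were 0, a resolution sending [B] into [K2] and one satisfying [phi] on [K2]
     would glue to a resolution that [h] excludes. *)
  case: notF => y0 y0x; apply/negP => /forall_inP in_K2.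
  have /negP[] := h _ (splice_resolution (b * l) y0x yx).
  by apply/forall_inP => s sB; rewrite spliced; apply: phi_y; apply: in_K2.
- rewrite any_true => /existsP[K2 /andP[FK GK]] y yx s sB.
  have [_ /(_ FK)hFB _] := hF K2; have [_ /(_ GK)hGB _] := hG K2.
  by apply: hGB => //; apply: hFB.
rewrite any_true expnD mulnA => le_card h.
(* The allowance left after the first segment is exactly what completeness of [G] asks for. *)
have leR: #|reach a b x B| * 2 ^ w <= 2 ^ k.
  by apply: leq_trans le_card; rewrite leq_mul2r card_reach orbT.
have leR': #|reach a b x B| <= 2 ^ k by apply: leq_trans leR; rewrite leq_pmulr ?expn_gt0.
apply/existsP; exists (exist _ (reach a b x B) leR'); apply/andP; split.
  have [_ _] := hF (exist _ (reach a b x B) leR'); apply=> [|y yx s sB].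
    by apply: leq_trans le_card; rewrite leq_pmulr ?expn_gt0.
  by apply/imsetP; exists (y, s); rewrite // inE /= yx.
have [_ _] := hG (exist _ (reach a b x B) leR'); apply=> // y yx s.
case/imsetP=> -[y0 s0] /setXP[/= y0x s0B] ->.
(* A reached state may stem from a resolution [y0] other than [y]; splicing turns the pair into one
   resolution. *)
by rewrite -spliced; apply: h => //; apply: splice_resolution.
Qed.

(** * Matrices of single symbols and their products *)

Definition positions (i : nat) : seq nat := iota (i * l) l.

Lemma positions_lt i : i < n -> all (fun p => p < l * n) (positions i).
Proof.
move=> ltin; apply/allP => p; rewrite mem_iota => /andP[_ ltp].
by apply: leq_trans ltp _; rewrite addnC -mulSn mulnC leq_mul2l ltin orbT.
Qed.

Definition symbol_of (ys : seq bool) : l.-tuple bool := [tuple nth false ys b | b < l].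

Lemma symbol_bits y i : symbol_of (bits (positions i) y) = symbol y i.
Proof.
apply: eq_from_tnth => b; rewrite !tnth_mktuple (nth_map 0) ?size_iota //.
by rewrite nth_iota.
Qed.

Definition symbol_test B (phi : S -> l.-tuple bool -> bool) (ys : seq bool) : bool :=
  [forall s in B, phi s (symbol_of ys)].

Lemma symbol_test_spec i B phi x b : i < n ->
  (mux_tree (symbol_test B phi) (positions i) x == Some b)
    = [forall y in resolution x, [forall s in B, phi s (symbol y i)] == b].
Proof.
move=> ltin; rewrite mux_tree_spec ?iota_uniq ?positions_lt //.
by apply: eq_forallb_in => y _; rewrite /symbol_test symbol_bits.
Qed.

(** Multiplexer trees are exact, so the entry is available for every [w]: the unstable count for
    matrices, 0 for output tests. *)
Lemma entry_symbol_test i B phi x w : i < n ->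
  entry x w B (fun y s => phi s (symbol y i))
    (mux_tree (symbol_test B phi) (positions i) x).
Proof.
move=> ltin; split=> [|| _ h]; rewrite symbol_test_spec //.
- by apply: eq_forallb_in => y _; rewrite eqbF_neg.
- by move=> /forall_inP h y /h /eqP /forall_inP.
by apply/forall_inP => y yx; apply/eqP/forall_inP; apply: h.
Qed.

Lemma run1 y i s : run y i i.+1 s = trans s (symbol y i).
Proof. by rewrite /run subSnn. Qed.

Definition computes_matrix gs d a b := a <= b /\
  exists F : small -> small -> (l * n).-tuple ternary -> ternary,
  (forall K1 K2, computes gs d (F K1 K2)) /\ forall x (K1 K2 : small),
     entry x (unstable a b x) (val K1) (fun y s => run y a b s \in val K2) (F K1 K2 x).

Lemma eq_entry x w B (phi psi : (l * n).-tuple bool -> S -> bool) F : (forall y s, phi y s = psi y s) ->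
  entry x w B phi F -> entry x w B psi F.
Proof.
move=> eqphi [h0 h1 h2]; split=> [|Ft y yx s sB|le h].
- by rewrite h0; apply: eq_forallb_in => y _; congr (~~ _); apply: eq_forallb_in.
- by rewrite -eqphi h1.
by apply: h2 => // y yx s sB; rewrite eqphi h.
Qed.

Lemma entry_leq x w w' B phi F : w <= w' -> entry x w B phi F -> entry x w' B phi F.
Proof.
move=> lew [h0 h1 h2]; split=> // le; apply: h2; apply: leq_trans le.
by rewrite leq_mul2l leq_exp2l ?lew ?orbT.
Qed.

Lemma small_gt0 : 0 < #|{: small}|.
Proof. by rewrite card_small /kappa big_nat_recl // bin0. Qed.

Lemma buildable_matrix_mul gs d a b c : acyclic (l * n) gs ->
    computes_matrix gs d a b -> computes_matrix gs d b c ->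
  buildable (l * n) (2 * #|{: small}| ^ 3) gs
    (fun gs' => computes_matrix gs' ((up_log 2 #|{: small}|).+1 + d) a c).
Proof.
move=> ac [leab [F [hF Fspec]]] [lebc [G [hG Gspec]]].
pose H (K1 K2 : small) := fun x =>
  kleene_any [seq kleene_and (F K1 K x) (G K K2 x) | K <- enum {: small}].
have ball: buildable (l * n) (size (enum {: small * small}) * (2 * #|{: small}|)) gs
    (fun gs' => forall BB, BB \in enum {: small * small} ->
       computes gs' ((up_log 2 #|{: small}|).+1 + d) (H BB.1 BB.2)).
  apply: buildable_all => // [BB gs1 gs2|BB gs1 _ ac1 pre1]; first exact: computes_extends.
  rewrite addSnnS; apply: buildable_any_and => // [|B|B]; first exact: small_gt0.
    exact: computes_extends pre1 (hF _ _).
  exact: computes_extends pre1 (hG _ _).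
have -> : 2 * #|{: small}| ^ 3 = size (enum {: small * small}) * (2 * #|{: small}|).
  by rewrite -cardE card_prod -mulnA !(mulnCA _ 2) !expnS expn0 muln1.
apply: buildable_imp ball => gs1 _ h1; split; first exact: leq_trans leab lebc.
exists H; split=> [K1 K2|x K1 K2]; first by apply: (h1 (K1, K2)); rewrite mem_enum.
apply: (@entry_leq x (unstable a b x + unstable b c x)).
  by apply: unstable_add; rewrite leab.
apply: (@eq_entry _ _ _ (fun y s => run y b c (run y a b s) \in val K2)).
  by move=> y s; rewrite -run_cat ?leab.
apply: (@entry_compose x a b _ (val K1) (fun y s => run y b c s \in val K2)) => //.
  exact: (valP K1).
move=> y y' s eqy; by rewrite (@eq_run y y') // => p /andP[lep _]; apply: eqy.
Qed.


(** A singleton [B] meets the cardinality premise as soon as [2 ^ w <= 2 ^ k], and the three clauses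
    then fix the stable values completely. *)
Lemma entry_start x w s0 phi F : 2 ^ w <= 2 ^ k -> entry x w [set s0] phi F ->
  forall b, (F == Some b) = [forall y in resolution x, phi y s0 == b].
Proof.
move=> lew [h0 h1 h2] [].
  apply/idP/forall_inP => [/h1 h y yx | h].
    by apply/eqP; apply: (h y yx); apply: set11.
  by apply: h2 => [|y yx s]; rewrite ?cards1 ?mul1n // inE => /eqP->; apply/eqP/h.
rewrite h0; apply: eq_forallb_in => y _; rewrite eqbF_neg; congr (~~ _).
apply/forall_inP/idP => [|h s]; first by move=> h; apply: h (set11 s0).
by rewrite inE => /eqP->.
Qed.

(** All functions of the last [q] bits of the symbol are built once; each test then adds only a tree
    over the other [l - q] bits. *)
Lemma buildable_tests (J : finType) (g : J -> seq bool -> bool) q i gs :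
    q <= l -> i < n -> acyclic (l * n) gs ->
  buildable (l * n) (12 * 2 ^ (2 ^ q) + #|J| * (6 * 2 ^ (l - q))) gs (fun gs' =>
    forall j, computes gs' (4 * l + 1) (@mux_tree (l * n) (g j) (positions i))).
Proof.
move=> leql ltin ac.
have posE : positions i = iota (i * l) (l - q) ++ iota (i * l + (l - q)) q.
  by rewrite -iotaD subnK.
have := positions_lt ltin; rewrite posE all_cat => /andP[all1 all2].
have := buildable_all_functions ac all2; rewrite size_iota.
move=> /buildable_bind; apply=> gs1 ac1 pre1 h1.
have ball: buildable (l * n) (size (enum J) * (6 * 2 ^ (l - q))) gs1 (fun gs' =>
    forall j, j \in enum J ->
      computes gs' (4 * l + 1) (@mux_tree (l * n) (g j) (positions i))).
  apply: buildable_all => // [j gs2 gs3|j gs2 _ ac2 pre2]; first exact: computes_extends.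
  have := buildable_mux_tree ac2 all1 (fun f => computes_extends pre2 (h1 f)) (g j).
  rewrite size_iota addnA -mulnDr subnK // -posE.
  by apply: buildable_leq; rewrite leq_mul2l leq_pred.
rewrite cardE; apply: buildable_imp ball => gs2 _ h j.
by rewrite -posE; apply: h; rewrite mem_enum.
Qed.

(** * Output wires of the whole machine *)

Variables (s0 : S) (I : finType) (out : I -> S -> l.-tuple bool -> bool).

Definition computes_output gs d i (j : I) := exists2 F, computes gs d F &
  forall x, count_mem None x <= k -> forall b,
    (F x == Some b) = [forall y in resolution x, out j (run y 0 i s0) (symbol y i) == b].

(** The summands of the budget are the symbol tests, the prefix products and the output columns. In
    the depth, [1 < n] counts the last product, absent for a single symbol. *)
Lemma buildable_outputs q : q <= l -> 0 < n ->
  let kap := #|{: small}| in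
  buildable (l * n)
    (n * (12 * 2 ^ (2 ^ q) + (kap * kap + kap * #|I|) * (6 * 2 ^ (l - q)))
     + (n * 2 * (2 * kap ^ 3) + n * (#|I| * (2 * kap)))) [::]
    (fun gs => forall i j, i < n ->
       computes_output gs (4 * l + 1 + (2 * trunc_log 2 n + (1 < n)) * (up_log 2 kap).+1) i j).
Proof.
move=> leql n0 kap; set d0 := 4 * l + 1; set U := (up_log 2 kap).+1.
(* Matrix entries and output tests of one symbol share the same lower tree layers. *)
pose g (j : small * small + small * I) := match j with
  | inl KK => symbol_test (val KK.1) (fun s sigma => trans s sigma \in val KK.2)
  | inr Kj => symbol_test (val Kj.1) (out Kj.2) end.
have cardJ : #|{: small * small + small * I}| = kap * kap + kap * #|I|.
  by rewrite card_sum !card_prod.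
have b1 : buildable (l * n) (size (iota 0 n) *
    (12 * 2 ^ (2 ^ q) + (kap * kap + kap * #|I|) * (6 * 2 ^ (l - q)))) [::]
    (fun gs => forall i, i \in iota 0 n -> forall j,
       computes gs d0 (@mux_tree (l * n) (g j) (positions i))).
  apply: buildable_all => // [i gs1 gs2 pre h j|i gs1].
    exact: computes_extends pre (h j).
  by rewrite mem_iota -cardJ => lti ac1 _; apply: buildable_tests.
rewrite size_iota in b1; apply: buildable_bind b1 _ => gs1 ac1 _ h1.
have {}h1 i j : i < n -> computes gs1 d0 (@mux_tree (l * n) (g j) (positions i)).
  by move=> lti; apply: h1; rewrite mem_iota.
have base i : i < n -> computes_matrix gs1 d0 i i.+1.
  move=> lti; split; first exact: leqnSn.
  exists (fun K1 K2 => mux_tree (g (inl (K1, K2))) (positions i)).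
  split=> [K1 K2|x K1 K2]; first exact: h1.
  apply: (@eq_entry _ _ _ (fun y s => trans s (symbol y i) \in val K2)) => [y s|].
    by rewrite run1.
  exact: entry_symbol_test (fun s sigma => trans s sigma \in val K2) _ _ lti.
have b2 := @buildable_prefixes (l * n) computes_matrix (2 * kap ^ 3) U _ _ _ n id gs1 d0 n0 ac1 base.
apply: buildable_bind (b2 _ _ _) _ => [gs gs' d a b pre|gs d d' a b led|gs d a b e|] {b2}.
- by move=> [leab [F [hF Fs]]]; split=> //; exists F; split=> // K1 K2; apply: computes_extends pre _.
- by move=> [leab [F [hF Fs]]]; split=> //; exists F; split=> // K1 K2; apply: computes_leq led _.
- exact: buildable_matrix_mul.
move=> gs2 ac2 pre2 /= h2; set d2 := (2 * _ * U + d0) in h2.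
set D := d0 + _ * U.
have b3 : buildable (l * n) (size (iota 0 n) * (size (enum I) * (2 * kap))) gs2
    (fun gs => forall i, i \in iota 0 n -> forall j, j \in enum I -> computes_output gs D i j).
  have Dext gs gs' i j : extends gs gs' -> computes_output gs D i j -> computes_output gs' D i j.
    by move=> pre [F hF Fs]; exists F => //; apply: computes_extends hF.
  apply: buildable_all => // [i gs gs' pre h j Ij|i gs]; first exact: Dext pre (h j Ij).
  rewrite mem_iota => lti ac pre; apply: buildable_all => // [j gs3 gs4|j gs3 _ ac3 pre3].
    exact: Dext.
  have {pre3}pre := extends_trans pre pre3.
  pose K0 : small := exist _ [set s0] (eq_ind_r (fun c => c <= 2 ^ k) (expn_gt0 2 k) (cards1 s0)).
  (* Before the first symbol the state is [s0], so its output is read off a multiplexer tree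
     directly. *)
  case: (posnP i) => [i0 | i_gt0].
    apply: buildable_ret => //; exists (mux_tree (g (inr (K0, j))) (positions i)).
      apply: computes_leq (computes_extends pre (computes_extends pre2 (h1 _ _ lti))).
      exact: leq_addr.
    move=> x _ b; rewrite symbol_test_spec // i0; apply: eq_forallb_in => y _ /=.
    congr (_ == b); apply/forall_inP/idP => [|h s]; first by move=> h; apply: h (set11 s0).
    by rewrite inE => /eqP->.
  (* Prefix number [i.-1] covers [[0, i)], the symbols read before symbol [i]. *)
  have [_ [F [hF Fs]]] := h2 i.-1 (leq_ltn_trans (leq_pred i) lti).
  rewrite prednK // in Fs.
  have hT K : computes gs3 d2 (@mux_tree (l * n) (g (inr (K, j))) (positions i)).
    apply: computes_leq (computes_extends pre (computes_extends pre2 (h1 _ _ lti))).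
    exact: leq_addl.
  have b := buildable_any_and small_gt0 ac3 (fun K => computes_extends pre (hF K0 K)) hT.
  apply: buildable_imp b => gs4 _ h; eexists.
    apply: computes_leq h; rewrite /D /d2 addnS -addSn.
    have -> : 1 < n by lia.
    change (U + (2 * trunc_log 2 n * U + d0) <= d0 + (2 * trunc_log 2 n + 1) * U).
    by rewrite mulnDl mul1n addnC -addnA addnCA.
  move=> x le_count; apply: (@entry_start x (unstable 0 i x + 0) s0
    (fun y s => out j (run y 0 i s) (symbol y i))).
    by rewrite addn0 leq_exp2l // (leq_trans (unstable_count i x)).
  apply: (@entry_compose x 0 i 0 [set s0] (fun y s => out j s (symbol y i))) => //.
  - by rewrite cards1 expn_gt0.
  - move=> y y' s eqy; congr (out j s _); apply: eq_symbol => p /andP[lep _]; exact: eqy.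
  - by move=> K; exact: Fs.
  by move=> K; exact: (@entry_symbol_test i (val K) (out j) x 0 lti).
rewrite size_iota -cardE in b3; apply: buildable_imp b3 => gs3 _ h i j lti.
by apply: h; rewrite ?mem_iota ?mem_enum.
Qed.

End Runs.

(** * Assembling the transducer *)

Lemma superposition_spec M (s : seq (M.-tuple ternary)) (j : 'I_M) (b : bool) : s != [::] ->
  (tnth (superposition s) j == Some b) = all (fun t => tnth t j == Some b) s.
Proof.
case: s => // t s _; rewrite /superposition /=.
elim: s t => [|t' s IHs] t /=; first by rewrite andbT.
rewrite IHs andbA tnth_mktuple /superpose; congr (_ && _).
by case: (tnth t j) => [[]|]; case: (tnth t' j) => [[]|]; case: (b).
Qed.

Lemma resolution_neq0 N (x : N.-tuple ternary) : resolution x != set0.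
Proof.
apply/set0Pn; exists [tuple odflt false (tnth x i) | i < N].
by apply/resolutionP => i; rewrite tnth_mktuple; case: (tnth x i).
Qed.

(** A superposition is stable only when all its members agree; this form matches
    [computes_output]. *)
Lemma hazard_free_ext_spec N M (f : N.-tuple bool -> M.-tuple bool) x j b :
  (tnth (hazard_free_ext f x) j == Some b) = [forall y in resolution x, tnth (f y) j == b].
Proof.
rewrite /hazard_free_ext superposition_spec.
  rewrite all_map; apply/allP/forall_inP => h y yx.
    by have := h y; rewrite mem_enum => /(_ yx); rewrite /= tnth_map.
  by rewrite /= tnth_map; apply/eqP; congr Some; apply/eqP/h; rewrite -mem_enum.
by rewrite -size_eq0 size_map -cardE cards_eq0 resolution_neq0.
Qed.

Lemma resolution_stable N (y : N.-tuple bool) : resolution (stable y) = [set y].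
Proof.
apply/setP => z; rewrite in_set1; apply/resolutionP/eqP => [h | -> i _]; last by rewrite tnth_map.
by apply: eq_from_tnth => i; have := h i; rewrite tnth_map => /(_ isT)[].
Qed.

(** A stable input contains no unstable bit and is its own only resolution. *)
Lemma hazard_free_implements N M k (C : circuit N M) f : hazard_free k C f -> implements C f.
Proof.
move=> hC x; rewrite hC; last first.
  by rewrite (count_memPn _) //; apply/negP => /mapP[].
by rewrite /hazard_free_ext resolution_stable /image_mem enum_set1.
Qed.

Lemma nth_concat_symbols m n (ys : n.-tuple (m.-tuple bool)) (j : 'I_(m * n)) (m0 : 0 < m)
    (lti : j %/ m < n) :
  tnth (concat_symbols ys) j = tnth (tnth ys (Ordinal lti)) (Ordinal (ltn_pmod j m0)).
Proof.
rewrite !(tnth_nth false) /= (tnth_nth [tuple of nseq m false]) /=.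
rewrite [in LHS](divn_eq j m); move: (j %/ m) (ltn_pmod j m0) => i.
move: (j %% m) => r ltr; elim: (tval ys) i => [|t s IHs] [|i] /=; rewrite ?nth_nil //.
- by rewrite nth_nseq if_same.
- by rewrite nth_nseq if_same.
- by rewrite nth_cat size_tuple mul0n ltr.
by rewrite nth_cat size_tuple mulSn -addnA ltnNge leq_addr /= addKn IHs.
Qed.

Lemma transcriptionE l m (L : {set m.-tuple bool}) (T : mealy (l.-tuple bool) {y | y \in L})
    n (y : (l * n).-tuple bool) (i : 'I_n) :
  tnth (transcription T (split_symbols y)) i =
    out (run (@trans _ _ T) y 0 i (start T)) (symbol y i).
Proof.
rewrite tnth_mktuple; congr out; last by rewrite tnth_mktuple.
rewrite /run subn0.
have -> : take i (split_symbols y) = map (symbol y) (iota 0 i).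
  apply: (@eq_from_nth _ [tuple of nseq l false]) => [|r].
    by rewrite size_take size_tuple ltn_ord size_map size_iota.
  rewrite size_take size_tuple ltn_ord => ltr; rewrite nth_take //.
  have ltrn := ltn_trans ltr (ltn_ord i).
  rewrite -[r in LHS]/(val (Ordinal ltrn)) -tnth_nth tnth_mktuple.
  by rewrite (nth_map 0) ?size_iota // nth_iota.
by elim: (iota 0 i) (start T) => //= r s IHs s0.
Qed.

(* Below [split_depth l] variables, all Boolean functions together still cost only
   O(2 ^ l / l), while a tree over the remaining ones has O(2 ^ l / l) leaves. *)
Definition split_depth l := (trunc_log 2 l).-1.

Lemma split_depth_le l : 0 < l -> split_depth l <= l.
Proof.
move=> l0; rewrite /split_depth (leq_trans (leq_pred _)) //.
by rewrite ltnW // (leq_trans (ltn_expl _ (ltnSn 1))) // trunc_logP.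
Qed.

(** The truncated logarithm gives [l < 2 ^ (trunc_log 2 l).+1], an exponent at most
    [split_depth l + 2]; hence the factor 4. *)
Lemma split_depth_leaves l : 0 < l -> l * 2 ^ (l - split_depth l) <= 4 * 2 ^ l.
Proof.
move=> l0; have leql := split_depth_le l0; rewrite /split_depth in leql *; set q := _.-1 in leql *.
rewrite -{3}(subnKC leql) expnD mulnA leq_mul2r; apply/orP; right.
rewrite -[4]/(2 ^ 2) -expnD; apply: ltnW; apply: leq_trans (trunc_log_ltn l (ltnSn 1)) _.
by rewrite leq_exp2l // /q; lia.
Qed.

Lemma split_depth_shared l : 0 < l -> l * 2 ^ (2 ^ split_depth l) <= 4 * 2 ^ l.
Proof.
move=> l0; rewrite /split_depth; set t := trunc_log 2 l.
have let_l : 2 ^ t <= l by apply: trunc_logP.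
(* At [t = 0] the predecessor stays 0 and [l < 2 ^ l] suffices. Otherwise [e = 2 ^ split_depth l] is
   at most [l / 2], so [l <= 2 * (l - e)]. *)
case: t let_l => [|t] /=; first by have := ltn_expl l (ltnSn 1); rewrite expn0 expn1; lia.
rewrite expnS => let_l; set e := 2 ^ t in let_l *.
have lel : l <= 2 * 2 ^ (l - e).
  have : l - e < 2 ^ (l - e) by apply: ltn_expl.
  lia.
have leel : e <= l by lia.
rewrite -{2}(subnK leel).
rewrite expnD mulnA leq_mul2r; apply/orP; right; lia.
Qed.

(** * Arithmetic of the size and depth bounds *)

Section RealBounds.
Variable R : realType.
Local Open Scope ring_scope.

Lemma trunc_log_le_log2 (a : nat) : (0 < a)%N -> (trunc_log 2 a)%:R <= log2 (a%:R : R).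
Proof.
move=> a0; have ln2 : 0 < ln (2 : R) by rewrite ln_gt0 // ltr1n.
rewrite /log2 ler_pdivlMr // mulr_natl -lnXn ?ltr0n //.
by rewrite ler_ln ?posrE ?exprn_gt0 ?ltr0n // -natrX ler_nat trunc_logP.
Qed.

Lemma size_bound (l n kap lam I : nat) : (0 < l)%N -> (0 < kap)%N -> (I <= lam)%N ->
  (n * (12 * 2 ^ (2 ^ split_depth l) + (kap * kap + kap * I) * (6 * 2 ^ (l - split_depth l)))
     + (n * 2 * (2 * kap ^ 3) + n * (I * (2 * kap))))%:R
  <= 72 * ((kap%:R ^+ 3 + (2 ^+ l / l%:R) * kap%:R ^+ 2 + 2 ^+ l * kap%:R * lam%:R) * n%:R) :> R.
Proof.
move=> l0 kap0 leI; set q := split_depth l.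
set A := (12 * 2 ^ (2 ^ q) + kap ^ 2 * (6 * 2 ^ (l - q)))%N.
(* The bound is multiplied by [l] to avoid division; 72 is [12 * 4] for shared functions plus
   [6 * 4] for trees. *)
have leA : (l * A <= 72 * (2 ^ l * kap ^ 2))%N.
  have h1 := split_depth_shared l0; have h2 := split_depth_leaves l0.
  rewrite -/q in h1 h2.
  have kap2 : (0 < kap ^ 2)%N by rewrite expn_gt0 kap0.
  rewrite /A mulnDr.
  have e1 : (l * (12 * 2 ^ (2 ^ q)) <= 48 * 2 ^ l * kap ^ 2)%N.
    apply: (@leq_trans (48 * 2 ^ l)%N); last by rewrite leq_pmulr.
    lia.
  have e2 : (l * (kap ^ 2 * (6 * 2 ^ (l - q))) <= kap ^ 2 * (24 * 2 ^ l))%N.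
    by rewrite mulnCA leq_mul2l; apply/orP; right; lia.
  apply: leq_trans (leq_add e1 e2) _; lia.
have leAR : A%:R <= 72 * ((2 ^+ l / l%:R) * kap%:R ^+ 2) :> R.
  rewrite mulrAC mulrA ler_pdivlMr ?ltr0n // mulrC -natrM.
  rewrite -!natrX -!natrM ler_nat; exact: leA.
set B := (12 * _ + _)%N.
(* The trees of the output tests go into the [lambda] term, as do the output products below. *)
have leB : (B <= A + 6 * (2 ^ l * kap * lam))%N.
  have e3 : (kap * I * 2 ^ (l - q) <= kap * lam * 2 ^ l)%N.
    by rewrite leq_mul ?leq_mul2l ?leI ?orbT // leq_exp2l // leq_subr.
  rewrite /B /A mulnDl -mulnn; lia.
have leC : (I * (2 * kap) <= 2 * (2 ^ l * kap * lam))%N.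
  have : (1 * (I * kap) <= 2 ^ l * (lam * kap))%N.
    by rewrite leq_mul ?expn_gt0 // leq_mul2r leI orbT.
  lia.
set t3 := kap%:R ^+ 3; set t2 := _ * kap%:R ^+ 2; set t1 := _ * lam%:R.
have t3E : (kap ^ 3)%:R = t3 by rewrite natrX.
have t1E : (2 ^ l * kap * lam)%:R = t1 by rewrite !natrM natrX.
have tot : (n * B + (n * 2 * (2 * kap ^ 3) + n * (I * (2 * kap))) <=
    n * (A + 4 * kap ^ 3 + 8 * (2 ^ l * kap * lam)))%N.
  have -> : (n * B + (n * 2 * (2 * kap ^ 3) + n * (I * (2 * kap))) =
      n * (B + 4 * kap ^ 3 + I * (2 * kap)))%N by ring.
  rewrite leq_mul2l; apply/orP; right; lia.
move: tot; rewrite -(ler_nat R) => /le_trans; apply.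
have -> : (n * (A + 4 * kap ^ 3 + 8 * (2 ^ l * kap * lam)))%:R
    = (A%:R + 4 * t3 + 8 * t1) * n%:R :> R.
  rewrite -t3E -t1E mulnC; move: (A) (kap ^ 3)%N (2 ^ l * _ * _)%N => a b c.
  by rewrite natrM 2!natrD !natrM.
rewrite mulrA ler_wpM2r //.
have t30 : 0 <= t3 by rewrite -t3E.
have t10 : 0 <= t1 by rewrite -t1E.
rewrite -/t2 in leAR; lra.
Qed.

Lemma depth_bound (l n kap : nat) : (0 < l)%N -> (1 < kap)%N -> (0 < n)%N ->
  (4 * l + 1 + (2 * trunc_log 2 n + (1 < n)) * (up_log 2 kap).+1)%:R
    <= 72 * (log2 kap%:R * log2 n%:R + l%:R) :> R.
Proof.
move=> l0 kap1 n0; have kap0 : (0 < kap)%N := ltnW kap1.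
set tn := trunc_log 2 n; set tk := trunc_log 2 kap.
have tk1 : (0 < tk)%N by rewrite trunc_log_gt0.
have tn1 : ((1 < n)%N <= tn)%N by case: ltnP => // n1; rewrite trunc_log_gt0.
have upk : (up_log 2 kap <= tk.+1)%N.
  by apply: up_log_min => //; apply: ltnW; apply: trunc_log_ltn.
(* Since [tk >= 1], [(up_log 2 kap).+1 <= 3 * tk]; the other factor is at most [3 * tn], also for
   [n = 1], where both sides vanish. *)
have le1 : (4 * l + 1 + (2 * tn + (1 < n)) * (up_log 2 kap).+1 <= 72 * (tk * tn + l))%N.
  have : ((2 * tn + (1 < n)) * (up_log 2 kap).+1 <= 3 * tn * (3 * tk))%N.
    by apply: leq_mul; lia.
  by rewrite mulnACA (mulnC tn); lia.
move: le1; rewrite -(ler_nat R) => /le_trans; apply.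
rewrite natrM ler_wpM2l // natrD lerD2r natrM.
by apply: ler_pM => //; apply: trunc_log_le_log2.
Qed.

End RealBounds.

Local Open Scope ring_scope.

Theorem theorem3p18 (R : realType) :
  exists c : R, 0 < c /\
    forall (k l m n : nat), (0 < l)%N -> (0 < m)%N -> (0 < n)%N -> (k <= n)%N ->
    forall (L : {set m.-tuple bool}) (T : mealy (l.-tuple bool) {y | y \in L}),
    let kap : R := (kappa k #|state T|)%:R in
    let lam : R := (lambda m #|state T| #|{: l.-tuple bool}|)%:R in
    exists C : circuit (l * n) (m * n),
      [/\ implements C (@bool_transcription l m L T n),
          hazard_free k C (@bool_transcription l m L T n),
          (circuit_size C)%:R <=
            c * ((kap ^+ 3 + (2 ^+ l / l%:R) * kap ^+ 2
                  + 2 ^+ l * kap * lam) * n%:R)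
        & (circuit_depth C)%:R <= c * (log2 kap * log2 n%:R + l%:R)].
Proof.
exists 72; split=> // k l m n l0 m0 n0 _ L T kap lam.
pose column (j : 'I_m) : {ffun state T * l.-tuple bool -> bool} :=
  [ffun u => tnth (val (out u.1 u.2)) j].
(* Equal output columns share their wires: this is where [lambda] comes from. *)
pose I := {c | c \in [set column j | j : 'I_m]}.
have in_cols (j : 'I_m) : column j \in [set column j | j : 'I_m] by apply: imset_f.
pose col_of (j : 'I_m) : I := exist _ (column j) (in_cols j).
(* There are at most [m] columns, and at most as many as Boolean functions on states and symbols. *)
have leI : (#|{: I}| <= lambda m #|state T| #|{: l.-tuple bool}|)%N.
  rewrite card_sig leq_min; apply/andP; split.
    by rewrite (leq_trans (leq_imset_card _ _)) // card_ord.
  by rewrite (leq_trans (max_card _)) // card_ffun card_prod card_bool.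
have ac0 : acyclic (l * n) [::] by [].
have := @buildable_outputs _ l n k (@trans _ _ T) (start T) I
  (fun c s sigma => val c (s, sigma)) (split_depth l) (split_depth_le l0) n0.
rewrite card_small => -[gs [ac _ size_gs outs]].
set d := (4 * l + 1 + _)%N in outs.
have lt_div (j : 'I_(m * n)) : (j %/ m < n)%N by rewrite ltn_divLR // [X in (_ < X)%N]mulnC.
(* Output wire [j] carries bit [j %% m] of output symbol [j %/ m]. *)
have /fin_all_exists2[F hF Fspec] (j : 'I_(m * n)) :=
  outs (j %/ m)%N (col_of (Ordinal (ltn_pmod j m0))) (lt_div j).
have [C [sizeC depthC evalC]] := circuit_of_netlist ac hF.
have hazC : hazard_free k C (@bool_transcription l m L T n).
  move=> x le_count; apply: eq_from_tnth => j; rewrite evalC.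
  have eqS b : (F j x == Some b) =
      (tnth (hazard_free_ext (@bool_transcription l m L T n) x) j == Some b).
    rewrite Fspec // hazard_free_ext_spec; apply: eq_forallb_in => y _.
    by rewrite (nth_concat_symbols _ m0 (lt_div j)) tnth_map transcriptionE /= ffunE.
  (* Two ternary values that equal [Some b] for the same [b] coincide. *)
  case F1: (F j x) => [b|]; first by apply/esym/eqP; rewrite -eqS F1.
  by case F2: (tnth _ j) => [b|//]; have := eqS b; rewrite F1 F2 eqxx.
(* The terms for [i = 0] and [i = 1] already give [1 + #|state T|], so the logarithm of [kappa] is
   positive. *)
have kap1 : (1 < kappa k #|state T|)%N.
  have S0 : (0 < #|state T|)%N by apply/card_gt0P; exists (start T).
  rewrite /kappa; have : (0 < minn #|state T| (2 ^ k))%N by rewrite leq_min S0 expn_gt0.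
  case: (minn _ _) => // M _; rewrite big_nat_recl // big_nat_recl // bin0 bin1.
  by rewrite add1n ltnS (leq_trans S0) ?leq_addr.
exists C; split=> //; first exact: hazard_free_implements hazC.
- rewrite sizeC; apply: le_trans (size_bound R n l0 (ltnW kap1) leI).
  by rewrite ler_nat.
- by apply: le_trans (depth_bound R l0 kap1 n0); rewrite ler_nat.
Qed.
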